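(* Assume $\sigma\in C^2(\mathbb{R})$. Then $$\big\|\mathrm{Cov}(\hat{\mathcal{I}}_2(\theta))\big\|_F\le\frac1N\,\Big\|\frac{\partial^2h_L(x)}{\partial\theta\partial\theta^\top}\Big\|_F^2\,\|\mathcal{I}(h_L)\|_F.$$
   Context: Setup. Fix an input $x\in\mathbb{R}^{n_0}$ and integers $L\ge1$, $n_1,\dots,n_L\ge1$. Network. The parameters are $\theta=(W_0,\dots,W_{L-1})$, with $W_l\in\mathbb{R}^{n_{l+1}\times(n_l+1)}$, viewed as a vector in $\mathbb{R}^{\dim\theta}$. Let $\sigma$ be applied entrywise. Set $h_0=x$ and $\bar h_l=(h_l^\top,1)^\top$. For $1\le l\le L-1$ let $h_l=\sigma(W_{l-1}\bar h_{l-1})$, and let $h_L=W_{L-1}\bar h_{L-1}\in\mathbb{R}^{n_L}$. Exponential family. The model is $p(y\mid x,\theta)=\exp(t(y)^\top h_L-F(h_L))$ with respect to a base measure $\nu$, where $t(y)\in\mathbb{R}^{n_L}$ and $F(h)=\log\int\exp(t(y)^\top h)\,d\nu(y)$. Assume $h_L$ lies in the interior of the natural parameter space. Write $\mathcal{I}(h_L)=\nabla^2F(h_L)=\mathrm{Cov}(t(y))$, with $y\sim p(y\mid x,\theta)$. Estimator. Let $\ell=\log p(y\mid x,\theta)$. With $N$ i.i.d. samples $y_i\sim p(y\mid x,\theta)$ and $\ell_i=\log p(y_i\mid x,\theta)$, let $\hat{\mathcal{I}}_2(\theta)=\frac1N\sum_i(-\frac{\partial^2\ell_i}{\partial\theta\partial\theta^\top})$.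 Notation. $\mathrm{Cov}(\hat{\mathcal{I}}_2(\theta))$ is the 4-tensor with entries $\mathrm{Cov}(\hat{\mathcal{I}}_2^{ij},\hat{\mathcal{I}}_2^{kl})$. $\frac{\partial^2h_L}{\partial\theta\partial\theta^\top}$ is the $n_L\times\dim\theta\times\dim\theta$ tensor of second derivatives. $\|\cdot\|_F$ is the square root of the sum of squared entries. *)

(* Defs.v *)
From HB Require Import structures.
From mathcomp Require Import all_boot all_order all_algebra.
From mathcomp Require Import all_classical all_reals all_analysis.
Set Implicit Arguments.
Unset Strict Implicit.
Unset Printing Implicit Defensive.
Import Order.TTheory GRing.Theory Num.Theory.
Import numFieldNormedType.Exports.
Local Open Scope classical_set_scope.
Local Open Scope ring_scope.

Section Network.
Variable R : realType.

Definition C2 (s : R -> R) : Prop :=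
  (forall z, derivable s z 1) /\ (forall z, derivable (derive1 s) z 1) /\
  continuous (derive1n 2 s).

(** Index set of the parameters theta = (W_0, ..., W_{L-1}):
    (l, i, j) with l < L, i < n_{l+1}, j < n_l + 1. *)
Definition PIdx (n : nat -> nat) (L : nat) : finType :=
  {l : 'I_L & ('I_(n l.+1) * 'I_(n l).+1)%type}.

(** dim theta, and theta viewed as a vector of R^{dim theta}
    (flattened through the canonical enumeration of PIdx). *)
Definition dimTheta (n : nat -> nat) (L : nat) : nat := #|{: PIdx n L}|.

Variables (n : nat -> nat) (L : nat) (sigma : R -> R).

(** entry (i, j) of W_l in theta (0 if (l, i, j) is not an index). *)
Definition theta_coord (theta : 'rV[R]_(dimTheta n L)) (l i j : nat) : R :=
  match [pick p : PIdx n L | [&& (val (tag p) == l),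
                                   (val (tagged p).1 == i) &
                                   (val (tagged p).2 == j)]] with
  | Some p => theta 0 (enum_rank p)
  | None => 0
  end.

Definition Wmat (theta : 'rV[R]_(dimTheta n L)) (l : nat)
  : 'M[R]_(n l.+1, (n l).+1) :=
  \matrix_(i, j) theta_coord theta l i j.

Definition hbar (m : nat) (h : 'cV[R]_m) : 'cV[R]_m.+1 :=
  \col_(j < m.+1) (if unlift ord_max j is Some j' then h j' 0 else 1).

Fixpoint layer (x : 'cV[R]_(n 0)) (theta : 'rV[R]_(dimTheta n L)) (k : nat)
  : 'cV[R]_(n k) :=
  match k return 'cV[R]_(n k) with
  | 0 => x
  | k'.+1 =>
      let z := Wmat theta k' *m hbar (layer x theta k') in
      if (k'.+1 < L)%N then map_mx sigma z else z
  end.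

Definition hL (x : 'cV[R]_(n 0)) (theta : 'rV[R]_(dimTheta n L))
  : 'cV[R]_(n L) := layer x theta L.

End Network.

Section Calculus.
Variable R : realType.

Definition ebasis (D : nat) (p : 'I_D) : 'rV[R]_D := delta_mx 0 p.

Definition d2 (D : nat) (f : 'rV[R]_D -> R) (theta : 'rV[R]_D) (p q : 'I_D)
  : R :=
  'D_(ebasis q) (fun th => 'D_(ebasis p) f th) theta.

End Calculus.

Section ExpFamily.
Variables (R : realType) (d : measure_display) (Y : measurableType d).
Variable (m : nat) (nu : {measure set Y -> \bar R}) (t : Y -> 'cV[R]_m).

Definition tdot (y : Y) (h : 'cV[R]_m) : R := \sum_(a < m) t y a 0 * h a 0.

Definition partfun (h : 'cV[R]_m) : \bar R :=
  (\int[nu]_y (expR (tdot y h))%:E)%E.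

Definition natparam : set 'cV[R]_m := [set h | (partfun h < +oo)%E].

Definition logpart (h : 'cV[R]_m) : R := ln (fine (partfun h)).

Definition expdens (h : 'cV[R]_m) (y : Y) : R := expR (tdot y h - logpart h).

Definition expfE (h : 'cV[R]_m) (f : Y -> R) : R :=
  fine (\int[nu]_y (f y * expdens h y)%:E)%E.

Definition fisherI (h : 'cV[R]_m) (a b : 'I_m) : R :=
  expfE h (fun y => (t y a 0 - expfE h (fun z => t z a 0)) *
                    (t y b 0 - expfE h (fun z => t z b 0))).

End ExpFamily.

Section Prob.
Variables (R : realType) (d : measure_display) (Om : measurableType d).
Variable (P : probability Om R).

Definition Exp (X : Om -> R) : R := fine (\int[P]_w (X w)%:E)%E.

Definition Cov (X Z : Om -> R) : R :=
  Exp (fun w => (X w - Exp X) * (Z w - Exp Z)).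

Definition mutually_independent (dY : measure_display) (Y : measurableType dY)
  (N : nat) (Ys : 'I_N -> Om -> Y) : Prop :=
  forall A : 'I_N -> set Y, (forall i, measurable (A i)) ->
    P (\bigcap_(i in [set: 'I_N]) (Ys i @^-1` A i)) =
    (\prod_(i < N) fine (P (Ys i @^-1` A i)))%:E.

End Prob.

(* Main.v *)
Require Import Defs.
From HB Require Import structures.
From mathcomp Require Import all_boot all_order all_algebra.
From mathcomp Require Import all_classical all_reals all_analysis.
From mathcomp Require Import measurable_realfun ring lra.
Import Order.TTheory GRing.Theory Num.Theory.
Import numFieldNormedType.Exports.
Local Open Scope classical_set_scope.
Local Open Scope ring_scope.
(** The log-likelihood is [t(y)^T h_L - F(h_L)], so the Hessian of [- l] in theta
    is [c - sum_a t_a(y) H_a], where [H_a] is the Hessian of the [a]-th output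
    and [c], the Hessian of [F o h_L], does not depend on [y].  Hence the
    covariance of the estimator is [1/N sum_{a,b} H_a (x) H_b I_ab], and the bound
    is the Cauchy-Schwarz inequality over the pairs [(a, b)].

    The analytic input is that [F] is twice differentiable near [h_L]: since
    [h_L] is interior, [exp(t.h_L + e |t|_1)] is integrable for some [e > 0], and
    [|exp u - 1 - u| <= u^2 exp |u|] then gives a second-order remainder for
    [h |-> int g exp(t.h) dnu] for every [g] of small exponential growth. *)

Set Implicit Arguments.
Unset Strict Implicit.
Unset Printing Implicit Defensive.

(** * Integration against a measure given by a density *)

Section Density.
Context (d : measure_display) (T : measurableType d) (R : realType).
Variables (mu nu : {measure set T -> \bar R}) (rho : T -> R).
Hypotheses (mrho : measurable_fun setT rho) (rho_ge0 : forall x, 0 <= rho x).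
Hypothesis mu_rho : forall A, measurable A ->
  mu A = (\int[nu]_(x in A) (rho x)%:E)%E.

Import HBNNSimple.

(** A simple function is a finite combination of indicators of its level sets, and on each level set
    the identity is [mu_rho]. *)
Lemma nnsfun_integral_density (h : {nnsfun T >-> R}) :
  (\int[nu]_x ((h x)%:E * (rho x)%:E) = \int[mu]_x (h x)%:E)%E.
Proof.
have mrhoE : measurable_fun setT (fun x => (rho x)%:E) by exact/measurable_EFinP.
have mind r : measurable_fun setT (fun x => (r * \1_(h @^-1` [set r]) x)%:E).
  by apply: (measurable_comp measurableT) => //; exact: measurable_funM.
transitivity (\int[mu]_x
    (\sum_(y \in range h) (y * \1_(h @^-1` [set y]) x)%:E))%E; last first.
  by apply: eq_integral => x _; rewrite /= fimfunE -fsumEFin.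
rewrite ge0_integral_fsum//; last by move=> y x _; exact: nnfun_muleindic_ge0.
transitivity (\int[nu]_x (\sum_(y \in range h)
    (y * \1_(h @^-1` [set y]) x)%:E * (rho x)%:E))%E.
  under [RHS]eq_integral => x _.
    rewrite -ge0_mule_fsuml => [|y]; last exact: nnfun_muleindic_ge0.
    rewrite fsumEFin // -(fimfunE _ x); over.
  by [].
rewrite ge0_integral_fsum//; last 2 first.
  - by move=> y; exact: emeasurable_funM.
  - move=> y x _; apply: mule_ge0; last by rewrite lee_fin.
    exact: nnfun_muleindic_ge0.
apply: eq_fsbigr => r rh.
under [RHS]eq_integral do rewrite EFinM.
rewrite integralZl_indic_nnsfun => //.
under eq_integral do rewrite EFinM -muleA.
rewrite ge0_integralZl//.
- under eq_integral do rewrite muleC.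
  rewrite (eq_integral ((EFin \o rho) \_ (h @^-1` [set r]))); last first.
    by move=> x _; rewrite epatch_indic.
  by rewrite -integral_mkcond integral_indic// setIT mu_rho.
- apply: emeasurable_funM => //.
  by apply/measurable_EFinP.
- by move=> x _; rewrite mule_ge0 ?lee_fin.
- by move: rh; rewrite inE => -[x _ <-]; rewrite lee_fin.
Qed.

(** Monotone convergence along the simple approximations [h n], used under [mu] and, after
    multiplication by [rho >= 0], under [nu]. *)
Lemma ge0_integral_density (f : T -> \bar R) : measurable_fun setT f ->
  (forall x, 0 <= f x)%E ->
  (\int[mu]_x f x = \int[nu]_x (f x * (rho x)%:E))%E.
Proof.
move=> mf f0.
have mrhoE : measurable_fun setT (fun x => (rho x)%:E) by exact/measurable_EFinP.
pose h := nnsfun_approx measurableT mf.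
have cvgh x : (EFin \o h n) x @[n --> \oo] --> f x.
  by apply: cvg_nnsfun_approx.
transitivity (lim (\int[mu]_x (EFin \o h n) x @[n --> \oo]))%E.
  under eq_integral => x _ do rewrite -(cvg_lim _ (cvgh x))//.
  apply: monotone_convergence => //.
  - by move=> n; apply/measurable_EFinP; exact/measurable_funP.
  - by move=> n x _; rewrite lee_fin.
  - by move=> x _ a b ab; rewrite lee_fin; exact/lefP/nd_nnsfun_approx.
transitivity (lim (\int[nu]_x ((EFin \o h n) x * (rho x)%:E)
    @[n --> \oo]))%E.
  by under [in RHS]eq_fun do rewrite nnsfun_integral_density.
have cvghr x : ((EFin \o h n) x * (rho x)%:E)%E @[n --> \oo]
    --> (f x * (rho x)%:E)%E.
  by apply: cvgeZr.
under [RHS]eq_integral => x _ do rewrite -(cvg_lim _ (cvghr x))//.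
apply/esym/monotone_convergence => //.
- move=> n; apply: emeasurable_funM => //.
  by apply/measurable_EFinP; exact/measurable_funP.
- by move=> n x _; rewrite mule_ge0 ?lee_fin.
- move=> x _ a b ab; rewrite lee_wpmul2r ?lee_fin//.
  exact/lefP/nd_nnsfun_approx.
Qed.

Lemma integrable_density (f : T -> R) : measurable_fun setT f ->
  nu.-integrable setT (fun x => (f x * rho x)%:E) ->
  mu.-integrable setT (EFin \o f).
Proof.
move=> mf /integrableP[_ fnu]; apply/integrableP; split.
  exact/measurable_EFinP.
rewrite ge0_integral_density//; last first.
  by do 2 apply: measurableT_comp => //.
rewrite (le_lt_trans _ fnu)// le_eqVlt; apply/orP; left; apply/eqP.
apply: eq_integral => x _ /=.
by rewrite -EFinM normrM (ger0_norm (rho_ge0 x)).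
Qed.

(** Multiplication by [rho >= 0] commutes with taking positive and negative parts, so the
    nonnegative case applies to each part. *)
Lemma integral_density (f : T -> R) : measurable_fun setT f ->
  (\int[mu]_x (f x)%:E = \int[nu]_x (f x * rho x)%:E)%E.
Proof.
move=> mf; have mfE : measurable_fun setT (fun x => (f x)%:E) by exact/measurable_EFinP.
rewrite integralE [RHS]integralE.
rewrite !ge0_integral_density//; last 2 first.
  exact: measurable_funeneg.
  exact: measurable_funepos.
have rhoE x : (0 <= (rho x)%:E)%E by rewrite lee_fin.
congr (_ - _)%E; apply: eq_integral => x _.
  by rewrite !funeposE /= EFinM maxe_pMl// ?mul0e.
by rewrite !funenegE maxe_pMl// mul0e mulNe -EFinM.
Qed.

End Density.

(** * Expectation of a product of independent variables *)

Section IndependentPair.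
Context (dO d : measure_display) (Om : measurableType dO)
  (Y : measurableType d) (R : realType) (P : probability Om R).
Variables (X Z : Om -> Y).
Hypotheses (mX : measurable_fun setT X) (mZ : measurable_fun setT Z).
Hypothesis indXZ : forall A B, measurable A -> measurable B ->
  P (X @^-1` A `&` Z @^-1` B) = (P (X @^-1` A) * P (Z @^-1` B))%E.

Let X_mfun : {mfun Om >-> Y} := HB.pack X (isMeasurableFun.Build _ _ _ _ _ mX).
Let Z_mfun : {mfun Om >-> Y} := HB.pack Z (isMeasurableFun.Build _ _ _ _ _ mZ).
Let muX : probability Y R := distribution P X_mfun.
Let muZ : probability Y R := distribution P Z_mfun.

Variables (f g : Y -> R).
Hypotheses (mf : measurable_fun setT f) (mg : measurable_fun setT g).
Hypotheses (intf : P.-integrable setT (EFin \o (f \o X)))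
  (intg : P.-integrable setT (EFin \o (g \o Z))).

Let XZ w := (X w, Z w).

Let mXZ : measurable_fun setT XZ.
Proof. exact: measurable_fun_pair. Qed.

(** Independence is agreement of the two measures on rectangles, which determine the product
    measure. *)
Let joint_law A : measurable A -> (muX \x muZ)%E A = pushforward P XZ A.
Proof.
move: A; apply: product_measure_unique => A B mA mB.
by rewrite /= -indXZ.
Qed.

Let mfg : measurable_fun setT (fun z : Y * Y => (f z.1 * g z.2)%:E).
Proof. by apply/measurable_EFinP/measurable_funM; exact: measurableT_comp. Qed.

(** By Tonelli the integral of the absolute value factors into the first absolute moments of [f]
    under [muX] and of [g] under [muZ], both finite. *)
Let fg_integrable :
  (muX \x muZ)%E.-integrable setT (fun z : Y * Y => (f z.1 * g z.2)%:E).
Proof.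
apply/integrable12ltyP => //=.
under eq_integral => x _.
  under eq_integral => y _ do rewrite normrM EFinM.
  rewrite ge0_integralZl//=; last by do 2 apply: measurableT_comp => //.
  over.
rewrite ge0_integralZr//=.
- rewrite lte_mul_pinfty//.
  + exact: integral_ge0.
  + rewrite ge0_fin_numE; last exact: integral_ge0.
    rewrite ge0_integral_pushforward//=; last by do 2 apply: measurableT_comp => //.
    by have /integrableP[] := intf.
  + rewrite ge0_integral_pushforward//=; last by do 2 apply: measurableT_comp => //.
    by have /integrableP[] := intg.
- by do 2 apply: measurableT_comp => //.
- exact: integral_ge0.
Qed.

Lemma integrable_indep_mul :
  P.-integrable setT (fun w => (f (X w) * g (Z w))%:E).
Proof.
apply/integrableP; split.
  apply/measurable_EFinP/measurable_funM; exact: measurableT_comp.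
have /integrableP[_] := fg_integrable; apply: le_lt_trans.
rewrite (eq_measure_integral (pushforward P XZ)); last first.
  by move=> A mA _; exact: joint_law.
by rewrite ge0_integral_pushforward//; apply: measurableT_comp.
Qed.

(** The expectation is moved to the joint law, which is the product law, and Fubini separates the
    two factors. *)
Lemma Rintegral_indep_mul :
  \int[P]_w (f (X w) * g (Z w)) = \int[P]_w f (X w) * \int[P]_w g (Z w).
Proof.
rewrite /Rintegral -fineM; try exact: integrable_fin_num.
congr fine.
transitivity (\int[pushforward P XZ]_z (f z.1 * g z.2)%:E)%E.
  rewrite integral_pushforward//=; exact: integrable_indep_mul.
rewrite -(eq_measure_integral (pushforward P XZ) (m1 := (muX \x muZ)%E)); last first.
  by move=> A mA _; exact: joint_law.
rewrite -integral12_prod_meas1//= /fubini_F/=.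
have intgZ : muZ.-integrable setT (EFin \o g).
  by apply: integrable_pushforward => //; exact/measurable_EFinP.
have intfX : muX.-integrable setT (EFin \o f).
  by apply: integrable_pushforward => //; exact/measurable_EFinP.
have gZE : (\int[muZ]_y (g y)%:E = \int[P]_w (g (Z w))%:E)%E.
  by rewrite integral_pushforward//; exact/measurable_EFinP.
have fXE : (\int[muX]_y (f y)%:E = \int[P]_w (f (X w))%:E)%E.
  by rewrite integral_pushforward//; exact/measurable_EFinP.
under eq_integral => x _.
  under eq_integral => y _ do rewrite EFinM.
  rewrite integralZl//= gZE -(fineK (integrable_fin_num _ intg))//.
  over.
by rewrite integralZr//= fXE fineK//; exact: integrable_fin_num.
Qed.

End IndependentPair.

(** * Cauchy-Schwarz and the Frobenius norm of a bilinear 4-tensor *)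

Lemma sum_CauchySchwarz (R : realFieldType) (I : finType) (a b : I -> R) :
  (\sum_i a i * b i) ^+ 2 <= (\sum_i a i ^+ 2) * (\sum_i b i ^+ 2).
Proof.
(* Lagrange's identity: this nonnegative double sum is twice the defect in the Cauchy-Schwarz
   inequality. *)
have : 0 <= \sum_i \sum_j (a i * b j - a j * b i) ^+ 2.
  by apply: sumr_ge0 => i _; apply: sumr_ge0 => j _; exact: sqr_ge0.
suff -> : \sum_i \sum_j (a i * b j - a j * b i) ^+ 2 =
    2 * ((\sum_i a i ^+ 2) * (\sum_i b i ^+ 2) - (\sum_i a i * b i) ^+ 2).
  by rewrite pmulr_rge0 ?ltr0n// subr_ge0.
have -> : \sum_i \sum_j (a i * b j - a j * b i) ^+ 2 =
    \sum_i \sum_j a i ^+ 2 * b j ^+ 2 + \sum_i \sum_j b i ^+ 2 * a j ^+ 2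
    - 2 * \sum_i \sum_j (a i * b i) * (a j * b j).
  rewrite mulr_sumr -big_split -sumrB; apply: eq_bigr => i _.
  rewrite mulr_sumr -big_split -sumrB; apply: eq_bigr => j _.
  by rewrite /=; ring.
by rewrite -!big_distrlr/= expr2; ring.
Qed.

(** For fixed [p q r s], Cauchy-Schwarz over pairs [(a, b)] separates [H a p q * H b r s] from
    [F a b]. The squared norm of the first factor is itself a product over [(p, q)] and [(r, s)], so
    summing it over the four indices gives the square of [S]. *)
Lemma frobenius_bilinear_le (R : rcfType) (A I : finType) (c : R)
    (H : A -> I -> I -> R) (F : A -> A -> R) : 0 <= c ->
  Num.sqrt (\sum_p \sum_q \sum_r \sum_s
    (c * \sum_a \sum_b H a p q * H b r s * F a b) ^+ 2)
  <= c * (\sum_a \sum_p \sum_q H a p q ^+ 2) *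
     Num.sqrt (\sum_a \sum_b F a b ^+ 2).
Proof.
move=> c0; set S := \sum_a \sum_p \sum_q H a p q ^+ 2; set T := \sum_a \sum_b F a b ^+ 2.
have S0 : 0 <= S.
  by do 3 (apply: sumr_ge0 => ? _); exact: sqr_ge0.
have T0 : 0 <= T by do 2 (apply: sumr_ge0 => ? _); exact: sqr_ge0.
have -> : c * S * Num.sqrt T = Num.sqrt ((c * S) ^+ 2 * T).
  by rewrite sqrtrM ?sqr_ge0// sqrtr_sqr ger0_norm ?mulr_ge0.
rewrite ler_wsqrtr//.
have -> : (c * S) ^+ 2 * T = \sum_p \sum_q \sum_r \sum_s
    c ^+ 2 * ((\sum_a H a p q ^+ 2) * (\sum_b H b r s ^+ 2) * T).
  have -> : S = \sum_p \sum_q \sum_a H a p q ^+ 2.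
    rewrite /S exchange_big; apply: eq_bigr => p _.
    by rewrite exchange_big.
  rewrite exprMn mulrAC [X in _ * X]expr2 mulr_suml mulr_sumr.
   apply: eq_bigr => p _; rewrite mulr_suml mulr_sumr.
  apply: eq_bigr => q _; rewrite [(\sum_a _) * _]mulr_sumr mulr_sumr.
  apply: eq_bigr => r _; rewrite [(\sum_a _) * _]mulr_sumr mulr_sumr.
  by apply: eq_bigr => s _; ring.
apply: ler_sum => p _; apply: ler_sum => q _.
apply: ler_sum => r _; apply: ler_sum => s _.
rewrite exprMn ler_wpM2l ?sqr_ge0// /T !pair_big/=.
have -> : (\sum_a H a p q ^+ 2) * (\sum_b H b r s ^+ 2) =
    \sum_(z : A * A) (H z.1 p q * H z.2 r s) ^+ 2.
  by rewrite big_distrlr/= pair_big/=; apply: eq_bigr => z _; rewrite exprMn.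
exact: sum_CauchySchwarz.
Qed.

(** * Integrals of finite linear combinations *)

Lemma integrableR_sum (d : measure_display) (T : measurableType d)
    (R : realType) (mu : {measure set T -> \bar R}) (I : Type) (s : seq I)
    (f : I -> T -> R) :
  (forall i, mu.-integrable setT (EFin \o f i)) ->
  mu.-integrable setT (EFin \o (fun x => \sum_(i <- s) f i x)).
Proof.
move=> intf; have := integrable_sum measurableT s (fun i (_ : true) => intf i).
by apply: eq_integrable => // x _ /=; rewrite sumEFin.
Qed.

Lemma Rintegral_sum (d : measure_display) (T : measurableType d) (R : realType)
    (mu : {measure set T -> \bar R}) (I : Type) (s : seq I) (f : I -> T -> R) :
  (forall i, mu.-integrable setT (EFin \o f i)) ->
  \int[mu]_x (\sum_(i <- s) f i x) = \sum_(i <- s) \int[mu]_x f i x.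
Proof.
move=> intf; elim: s => [|i s IH].
  under eq_Rintegral do rewrite big_nil.
  by rewrite big_nil /Rintegral integral0.
under eq_Rintegral do rewrite big_cons.
by rewrite big_cons -IH RintegralD//; exact: integrableR_sum.
Qed.

Lemma integrableRZ (d : measure_display) (T : measurableType d)
    (R : realType) (mu : {measure set T -> \bar R}) (k : R) (f : T -> R) :
  mu.-integrable setT (EFin \o f) ->
  mu.-integrable setT (EFin \o (fun x => k * f x)).
Proof. by move=> /(integrableZl measurableT k); apply: eq_integrable. Qed.

(** * Covariance of affine functions of centred uncorrelated samples *)

Section CovarianceOfMean.
Context (d : measure_display) (Om : measurableType d) (R : realType)
  (P : probability Om R).

Lemma integrable_cst_prob (c : R) : P.-integrable setT (EFin \o cst c).
Proof. exact: finite_measure_integrable_cst. Qed.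

Lemma Exp_affine (c : R) (X : Om -> R) : P.-integrable setT (EFin \o X) ->
  Exp P (fun w => c + X w) = c + Exp P X.
Proof.
move=> intX; rewrite /Exp -!/(Rintegral _ _ _) RintegralD//; last first.
  exact: integrable_cst_prob.
rewrite Rintegral_cst// [X in fine X](_ : _ = 1%E) ?mulr1//.
exact: probability_setT.
Qed.

Variables (I A : finType) (X : I -> A -> Om -> R) (F : A -> A -> R).
Hypothesis intX : forall i a, P.-integrable setT (EFin \o X i a).
Hypothesis EX : forall i a, Exp P (X i a) = 0.
Hypothesis intXX : forall i j a b,
  P.-integrable setT (EFin \o (fun w => X i a w * X j b w)).
Hypothesis EXX : forall i j a b,
  Exp P (fun w => X i a w * X j b w) = if i == j then F a b else 0.

(** Since each [X i a] is centred, [c] and [c'] are the means and cancel. In the expanded product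
    the terms with [i != j] vanish by [EXX], and the [#|I|] diagonal terms are equal. *)
Lemma Cov_affine_sum (k c c' : R) (u v : A -> R) :
  Cov P (fun w => c + k * \sum_i \sum_a u a * X i a w)
        (fun w => c' + k * \sum_i \sum_a v a * X i a w)
  = k ^+ 2 * #|I|%:R * \sum_a \sum_b u a * v b * F a b.
Proof.
have Eu e (x : A -> R) : Exp P (fun w => e + k * \sum_i \sum_a x a * X i a w) = e.
  have intS : P.-integrable setT (EFin \o (fun w => \sum_i \sum_a x a * X i a w)).
    by do 2 apply: integrableR_sum => ?; exact: integrableRZ.
  rewrite Exp_affine; last exact: integrableRZ.
  rewrite /Exp -!/(Rintegral _ _ _) RintegralZl// Rintegral_sum; last first.
    by move=> i; apply: integrableR_sum => ?; exact: integrableRZ.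
  rewrite big1 ?mulr0 ?addr0// => i _; rewrite Rintegral_sum; last first.
    by move=> a; exact: integrableRZ.
  rewrite big1// => a _; rewrite RintegralZl//.
  by have := EX i a; rewrite /Exp -/(Rintegral _ _ _) => ->; rewrite mulr0.
rewrite /Cov !Eu.
have -> : (fun w => (c + k * (\sum_i \sum_a u a * X i a w) - c) *
                    (c' + k * (\sum_i \sum_a v a * X i a w) - c')) =
  (fun w => \sum_i \sum_j \sum_a \sum_b
     k ^+ 2 * (u a * v b) * (X i a w * X j b w)).
  apply/funext => w; rewrite (addrC c) addrK (addrC c') addrK mulrACA -expr2.
  rewrite big_distrlr/= mulr_sumr; apply: eq_bigr => i _.
  rewrite mulr_sumr; apply: eq_bigr => j _.
  rewrite big_distrlr/= mulr_sumr; apply: eq_bigr => a _.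
  rewrite mulr_sumr; apply: eq_bigr => b _.
  by ring.
rewrite /Exp -/(Rintegral _ _ _).
have int4 i j a b : P.-integrable setT
    (EFin \o (fun w => k ^+ 2 * (u a * v b) * (X i a w * X j b w))).
  exact: integrableRZ.
rewrite Rintegral_sum; last by move=> i; do 3 apply: integrableR_sum => ?.
transitivity (\sum_(i : I) k ^+ 2 * \sum_a \sum_b u a * v b * F a b); last first.
  by rewrite sumr_const -[LHS]mulr_natr [RHS]mulrAC.
apply: eq_bigr => i _.
rewrite Rintegral_sum; last by move=> j; do 2 apply: integrableR_sum => ?.
have term j : \int[P]_w (\sum_a \sum_b
     k ^+ 2 * (u a * v b) * (X i a w * X j b w)) =
   \sum_a \sum_b k ^+ 2 * (u a * v b) * (if i == j then F a b else 0).
  rewrite Rintegral_sum; last by move=> a; apply: integrableR_sum => ?.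
  apply: eq_bigr => a _; rewrite Rintegral_sum//; apply: eq_bigr => b _.
  by rewrite RintegralZl// -EXX.
under eq_bigr do rewrite term.
rewrite (bigD1 i)//= [X in _ + X]big1 ?addr0; last first.
  move=> j /negbTE ji; rewrite big1// => a _; rewrite big1// => b _.
  by rewrite eq_sym ji mulr0.
rewrite eqxx mulr_sumr; apply: eq_bigr => a _.
by rewrite mulr_sumr; apply: eq_bigr => b _; rewrite -[LHS]mulrA.
Qed.

End CovarianceOfMean.

(** * Twice differentiable real functions on a normed space *)

Section Calculus.
Context {R : realType} {V : normedModType R}.
Implicit Types (f g : V -> R) (x v : V).

Lemma derive_compR (s : R -> R) f x v :
  derivable s (f x) 1 -> differentiable f x ->
  'D_v (fun y => s (f y)) x = derive1 s (f x) * 'D_v f x.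
Proof.
move=> ds df; have ds' : differentiable s (f x) by exact/derivable1_diffP.
rewrite (_ : (fun y => s (f y)) = s \o f)// deriveE; last first.
  exact: differentiable_comp.
by rewrite diff_comp//= deriv1E// deriveE// mulrC.
Qed.

(** Second order is phrased through directional derivatives because [d2] iterates ['D_v]; in this
    form stability under sums, products and composition follows from the first-order rules. *)
Definition twice_differentiable f :=
  (forall x, differentiable f x) /\
  (forall v x, differentiable (fun y => 'D_v f y) x).

Lemma twice_differentiable_cst (c : R) : twice_differentiable (fun=> c).
Proof.
split=> [x|v x]; first exact: differentiable_cst.
rewrite [X in differentiable X _](_ : _ = cst 0); first exact: differentiable_cst.
by apply/funext => y; exact: derive_cst.
Qed.

Lemma twice_differentiableD f g :
  twice_differentiable f -> twice_differentiable g ->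
  twice_differentiable (fun x => f x + g x).
Proof.
move=> [df ddf] [dg ddg]; split=> [x|v x]; first exact: differentiableD.
rewrite [X in differentiable X _](_ : _ = (fun y => 'D_v f y) + (fun y => 'D_v g y)).
  exact: differentiableD.
apply/funext => y; rewrite -[LHS]/('D_v (f + g) y) deriveD//.
  exact: diff_derivable.
exact: diff_derivable.
Qed.

Lemma twice_differentiableM f g :
  twice_differentiable f -> twice_differentiable g ->
  twice_differentiable (fun x => f x * g x).
Proof.
move=> [df ddf] [dg ddg]; split=> [x|v x]; first exact: differentiableM.
rewrite [X in differentiable X _](_ : _ =
  (f * (fun y => 'D_v g y)) + (g * (fun y => 'D_v f y))).
  by apply: differentiableD; apply: differentiableM.
apply/funext => y; rewrite -[LHS]/('D_v (f * g) y) deriveM//.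
  exact: diff_derivable.
exact: diff_derivable.
Qed.

Lemma twice_differentiable_sum (I : Type) (s : seq I) (f : I -> V -> R) :
  (forall i, twice_differentiable (f i)) ->
  twice_differentiable (fun x => \sum_(i <- s) f i x).
Proof.
move=> df; elim: s => [|i s IH].
  under eq_fun do rewrite big_nil; exact: twice_differentiable_cst.
under eq_fun do rewrite big_cons; exact: twice_differentiableD.
Qed.

(** By the chain rule the directional derivative is [derive1 s] at [f], times ['D_v f]: a product of
    differentiable functions. *)
Lemma twice_differentiable_comp (s : R -> R) f :
  (forall z, derivable s z 1) -> (forall z, derivable (derive1 s) z 1) ->
  twice_differentiable f -> twice_differentiable (fun x => s (f x)).
Proof.
move=> ds dds [df ddf]; split=> [x|v x].
  by apply: differentiable_comp => //; exact/derivable1_diffP.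
rewrite [X in differentiable X _](_ : _ = (derive1 s \o f) * (fun y => 'D_v f y)).
  apply: differentiableM => //; apply: differentiable_comp => //.
  exact/derivable1_diffP.
by apply/funext => y; rewrite derive_compR.
Qed.

End Calculus.

Lemma twice_differentiable_coord (R : realType) (m n : nat) (i : 'I_m)
    (j : 'I_n) : twice_differentiable (fun M : 'M[R]_(m, n) => M i j).
Proof.
split=> [x|v x]; first exact: differentiable_coord.
rewrite [X in differentiable X _](_ : _ = cst (v i j)); first exact: differentiable_cst.
apply/funext => M.
have := @derivable_id R 'M[R]_(m, n) M v.
by move=> /derive_mx/matrixP/(_ i j); rewrite derive_id mxE => ->.
Qed.

(** * Smoothness of the network in its parameters *)

Section NetworkSmoothness.
Context (R : realType) (n : nat -> nat) (L : nat) (sigma : R -> R).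
Hypotheses (dsigma : forall z, derivable sigma z 1)
  (ddsigma : forall z, derivable (derive1 sigma) z 1).

Lemma twice_differentiable_theta_coord (l i j : nat) :
  twice_differentiable
    (fun theta : 'rV[R]_(dimTheta n L) => theta_coord theta l i j).
Proof.
rewrite /theta_coord; case: pickP => [p _|_].
  exact: twice_differentiable_coord.
exact: twice_differentiable_cst.
Qed.

(** Induction on depth: a pre-activation is a sum of products of a parameter with an earlier output
    or with the constant bias input 1, and hidden layers then compose with [sigma]. *)
Lemma twice_differentiable_layer (x : 'cV[R]_(n 0%N)) (k : nat) (i : 'I_(n k)) :
  twice_differentiable
    (fun theta : 'rV[R]_(dimTheta n L) => layer sigma x theta k i 0).
Proof.
elim: k i => [|k IH] i /=; first exact: twice_differentiable_cst.
have dz : twice_differentiable (fun theta : 'rV[R]_(dimTheta n L) =>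
    (Wmat theta k *m hbar (layer sigma x theta k)) i 0).
  under eq_fun do rewrite mxE.
  apply: twice_differentiable_sum => j.
  under eq_fun do rewrite !mxE.
  apply: twice_differentiableM; first exact: twice_differentiable_theta_coord.
  by case: unlift => [j'|]; [exact: IH|exact: twice_differentiable_cst].
case: (k.+1 < L)%N => //; under eq_fun do rewrite mxE.
exact: twice_differentiable_comp.
Qed.

End NetworkSmoothness.

(** * Second-order remainders *)

Lemma expR_taylor1_le (R : realType) (u : R) :
  `|expR u - 1 - u| <= u ^+ 2 * expR `|u|.
Proof.
have lo : 0 <= expR u - 1 - u.
  by have := expR_ge1Dx u; lra.
(* With [1 - u <= expR (- u)] this gives [expR u - 1 - u <= u * (expR u - 1)] for either sign of
   [u]; the two cases then bound [expR u - 1] by [u * expR u] and by [u] from below. *)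
have up : expR u - 1 <= u * expR u.
  have := expR_ge1Dx (- u); rewrite expRN => hu.
  have : (1 - u) * expR u <= 1.
    by rewrite -ler_pdivlMr ?expR_gt0// div1r.
  by lra.
rewrite ger0_norm//; have [u0|u0] := leP 0 u.
  rewrite ger0_norm// expr2 -mulrA; apply: (@le_trans _ _ (u * (expR u - 1))).
    by lra.
  by rewrite ler_wpM2l.
have e1 : 1 <= expR `|u| by rewrite -[leLHS]expR0 ler_expR.
have e2 : expR u - 1 - u <= u ^+ 2.
  have : u * (expR u - 1) <= u * u by rewrite ler_nM2l//; have := expR_ge1Dx u; lra.
  by rewrite expr2; lra.
by rewrite (le_trans e2)// ler_peMr// sqr_ge0.
Qed.

(** A quadratic remainder is little-o of the increment: for tolerance [ep] it suffices that the
    increment has norm at most [ep / K]. *)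
Lemma is_diff_quadratic (R : realType) (V : normedModType R) (f : V -> R)
    (df : {linear V -> R}) (x : V) (K e : R) : 0 < K -> 0 < e ->
  continuous df ->
  (forall k, `|k| <= e -> `|f (x + k) - f x - df k| <= K * `|k| ^+ 2) ->
  is_diff x f df.
Proof.
move=> K0 e0 cdf HK.
have Do : f \o shift x = cst (f x) + df +o_ 0 id.
  apply/eqaddoP => ep ep0; near=> k.
  have ke : `|k| <= e.
    by near: k; apply/nbhs_normP; exists e => // k /=; rewrite sub0r normrN => /ltW.
  have kep : `|k| <= ep / K.
    near: k; apply/nbhs_normP; exists (ep / K); first exact: divr_gt0.
    by move=> k /=; rewrite sub0r normrN => /ltW.
  rewrite !fctE/= opprD addrA [k + x]addrC (le_trans (HK k ke))//.
  by rewrite expr2 mulrA ler_wpM2r// mulrC -ler_pdivlMr.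
have dE : 'd f x = df :> (V -> R) by exact: diff_unique.
by split=> //; apply/diff_locallyP; rewrite dE.
Unshelve. all: by end_near. Qed.

Lemma coord_le_mx_norm (R : realType) (m n : nat) (M : 'M[R]_(m, n)) i j :
  `|M i j| <= `|M|.
Proof.
rewrite [leRHS]/Num.Def.normr/= mx_normrE.
exact: (le_bigmax _ (fun ij : 'I_m * 'I_n => `|M ij.1 ij.2|) (i, j)).
Qed.

(** * Exponential integrals near an interior natural parameter *)

Section ExponentialMoments.
Context (R : realType) (d : measure_display) (Y : measurableType d) (m : nat)
  (nu : {measure set Y -> \bar R}) (t : Y -> 'cV[R]_m).
Hypothesis mt : forall a, measurable_fun setT (fun y => t y a 0).

Let S (y : Y) : R := \sum_a `|t y a 0|.

Let S_ge0 y : 0 <= S y. Proof. exact: sumr_ge0. Qed.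

Let measurable_S : measurable_fun setT S.
Proof. by apply: measurable_sum => a; exact: measurableT_comp. Qed.

Lemma measurable_tdot (h : 'cV[R]_m) : measurable_fun setT (fun y => tdot t y h).
Proof. by apply: measurable_sum => a; exact: measurable_funM. Qed.

Lemma tdotD y (h k : 'cV[R]_m) : tdot t y (h + k) = tdot t y h + tdot t y k.
Proof.
by rewrite /tdot -big_split; apply: eq_bigr => a _; rewrite mxE mulrDr.
Qed.

Lemma norm_tdot_le y (k : 'cV[R]_m) : `|tdot t y k| <= S y * `|k|.
Proof.
rewrite (le_trans (ler_norm_sum _ _ _))// /S mulr_suml ler_sum// => a _.
by rewrite normrM ler_wpM2l// coord_le_mx_norm.
Qed.

(* [S y] is [tdot t y] of a sign vector, so the exponential is dominated by its
   sum over the corners of a cube inside the natural parameter space. *)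
Lemma integrable_expR_tdot_norm (h0 : 'cV[R]_m) :
  interior (natparam nu t) h0 -> exists2 e : R, 0 < e &
    nu.-integrable setT (fun y => (expR (tdot t y h0 + e * S y))%:E).
Proof.
move=> /nbhs_ballP[e /= e0 he]; exists (e / 2); first by rewrite divr_gt0.
(* The matrix norm is the sup norm, so every corner lies at distance at most [dl] from [h0]; half
   the radius keeps it strictly inside the ball. *)
set dl := e / 2; have dl0 : 0 < dl by rewrite divr_gt0.
pose corner (s : {ffun 'I_m -> bool}) : 'cV[R]_m :=
  \col_a (h0 a 0 + dl * (-1) ^+ s a).
have corner_int s : nu.-integrable setT (EFin \o (fun y => expR (tdot t y (corner s)))).
  have mexp : measurable_fun setT (fun y => expR (tdot t y (corner s))).
    by apply: measurableT_comp => //; exact: measurable_tdot.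
  apply/integrableP; split; first exact/measurable_EFinP.
  have : natparam nu t (corner s).
    apply: he; split=> // a j; rewrite ord1 mxE /ball/= opprD addNKr normrN.
    rewrite normrM normrX normrN1 expr1n mulr1 gtr0_norm// /dl.
    by rewrite ltr_pdivrMr// ltr_pMr// ltr1n.
  rewrite /natparam/= /partfun; apply: le_lt_trans.
  rewrite le_eqVlt; apply/orP; left; apply/eqP/eq_integral => y _ /=.
  by rewrite ger0_norm ?expR_ge0.
have mW : measurable_fun setT (fun y => expR (tdot t y h0 + dl * S y)).
  apply: measurableT_comp => //; apply: measurable_funD.
    exact: measurable_tdot.
  exact: measurable_funM.
have := integrableR_sum (index_enum _) corner_int.
apply: le_integrable => //; first exact/measurable_EFinP.
move=> y _ /=; rewrite lee_fin ger0_norm ?expR_ge0// ger0_norm; last first.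
  by apply: sumr_ge0 => s _; exact: expR_ge0.
(* The corner following the signs of [t y] realises the exponent [tdot t y h0 + dl * S y]; the other
   corners only add nonnegative terms. *)
pose s0 : {ffun 'I_m -> bool} := [ffun a => t y a 0 < 0].
rewrite (bigD1 s0)//= [X in expR X <= _](_ : _ = tdot t y (corner s0)).
  by rewrite lerDl sumr_ge0// => s _; exact: expR_ge0.
rewrite /tdot /S mulr_sumr -big_split; apply: eq_bigr => a _ /=.
rewrite mxE ffunE mulrDr; congr (_ + _).
case: ltP => ta; first by rewrite ltr0_norm// expr1; ring.
by rewrite ger0_norm// expr0; ring.
Qed.

(** A weighted Laplace transform: weight 1 gives the real-valued partition function, and
    differentiating in coordinate [a] multiplies the weight by the [a]-th statistic. *)
Definition expint (g : Y -> R) (h : 'cV[R]_m) : R :=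
  \int[nu]_y (g y * expR (tdot t y h)).

Variables (h0 : 'cV[R]_m) (e : R).
Hypothesis e_gt0 : 0 < e.
Let W (y : Y) : R := expR (tdot t y h0 + (4 * e) * S y).
Hypothesis intW : nu.-integrable setT (EFin \o W).

Let normrW y : `|W y| = W y. Proof. by rewrite ger0_norm// expR_ge0. Qed.

Lemma le_expR_S y : S y <= e^-1 * expR (e * S y).
Proof.
rewrite mulrC ler_pdivlMr// mulrC (le_trans _ (expR_ge1Dx _))//.
by rewrite lerDr.
Qed.

(** The constant comes from [1 + z ^+ 2 / 2 <= expR z] at [z = e * S y]. *)
Lemma le_expR_S2 y : S y ^+ 2 <= 2 * e ^- 2 * expR (e * S y).
Proof.
have := @expR_ge1Dxn _ (e * S y) 1 (mulr_ge0 (ltW e_gt0) (S_ge0 y)).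
rewrite -(ler_pM2l (_ : 0 < 2 * e ^- 2)); last first.
  by rewrite mulr_gt0// invr_gt0 exprn_gt0.
apply: le_trans; rewrite mulrDr mulr1 exprMn.
rewrite (_ : 2 * e ^- 2 * (e ^+ 2 * S y ^+ 2 / 2`!%:R) = S y ^+ 2); last first.
  by rewrite !factS fact0 !muln1; field; rewrite gt_eqF.
by rewrite lerDr mulr_ge0// invr_ge0 exprn_ge0// ltW.
Qed.

(* [W] leaves [4 e] of room in the exponent: a factor in [subexp j] uses [j e] of
   it, and moving the parameter by [i e] away from [h0] uses [i e]. *)
Definition subexp (j : nat) (g : Y -> R) :=
  measurable_fun setT g /\
  exists2 C : R, 0 <= C & forall y, `|g y| <= C * expR (j%:R * e * S y).

Lemma subexp_cst1 : subexp 1 (fun=> 1).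
Proof.
split; first exact: measurable_cst.
exists 1 => // y; rewrite normr1 mul1r.
by rewrite -[leLHS]expR0 ler_expR !mulr_ge0// ltW.
Qed.

Lemma subexp_t a : subexp 1 (fun y => t y a 0).
Proof.
split; first exact: mt.
exists e^-1; first by rewrite invr_ge0 ltW.
move=> y; rewrite mul1r; apply: le_trans (le_expR_S y).
by rewrite /S (bigD1 a)//= lerDl sumr_ge0.
Qed.

Lemma subexpB_cst j g (c : R) : subexp j g -> subexp j (fun y => g y - c).
Proof.
move=> [mg [C C0 gC]]; split; first exact: measurable_funB.
exists (C + `|c|); first by rewrite addr_ge0.
move=> y; rewrite (le_trans (ler_normB _ _))// mulrDl lerD// ler_peMr//.
by rewrite -[leLHS]expR0 ler_expR !mulr_ge0// ltW.
Qed.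

Lemma subexpM i j f g : subexp i f -> subexp j g ->
  subexp (i + j) (fun y => f y * g y).
Proof.
move=> [mf [C C0 fC]] [mg [C' C'0 gC']]; split; first exact: measurable_funM.
exists (C * C'); first exact: mulr_ge0.
move=> y; rewrite normrM natrD mulrDl mulrDl expRD mulrACA.
exact: ler_pM.
Qed.

Lemma expR_tdot_le (i : nat) y (h : 'cV[R]_m) : `|h - h0| <= i%:R * e ->
  expR (tdot t y h) <= expR (tdot t y h0 + i%:R * e * S y).
Proof.
move=> hh; rewrite ler_expR -{1}(subrK h0 h) addrC tdotD lerD2l.
rewrite (le_trans (ler_norm _))// (le_trans (norm_tdot_le _ _))// mulrC.
by rewrite ler_wpM2r.
Qed.

(** The integrand is dominated by [C * W]: the shift from [h0] costs [i e] in the exponent, the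
    factor [g] costs [j e], and [i + j <= 4] fits the room left by [W]. *)
Lemma integrable_subexp (i j : nat) g (h : 'cV[R]_m) : (i + j <= 4)%N ->
  subexp j g -> `|h - h0| <= i%:R * e ->
  nu.-integrable setT (EFin \o (fun y => g y * expR (tdot t y h))).
Proof.
move=> ij4 [mg [C C0 gC]] hh; have := integrableRZ C intW.
apply: le_integrable => //.
  apply/measurable_EFinP/measurable_funM => //.
  by apply: measurableT_comp => //; exact: measurable_tdot.
move=> y _ /=; rewrite lee_fin [leRHS]normrM normrW (ger0_norm C0).
rewrite normrM (ger0_norm (expR_ge0 _)).
apply: (@le_trans _ _
    ((C * expR (j%:R * e * S y)) * expR (tdot t y h0 + i%:R * e * S y))).
  by apply: ler_pM => //; exact: expR_tdot_le.
rewrite -mulrA ler_wpM2l// -expRD ler_expR /= addrCA lerD2l -mulrDl.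
rewrite ler_wpM2r// -mulrDl ler_wpM2r ?(ltW e_gt0)//.
by rewrite -natrD ler_nat addnC.
Qed.

(** The difference integrates [g y * expR (tdot t y h)] times the first-order Taylor remainder of
    [expR] at [tdot t y k], which is bounded pointwise by a multiple of [W]. *)
Lemma expint_taylor1_le g : subexp 1 g -> exists2 K : R, 0 < K &
  forall h k : 'cV[R]_m, `|h - h0| <= e -> `|k| <= e ->
  `|expint g (h + k) - expint g h -
    \sum_a k a 0 * expint (fun y => g y * t y a 0) h| <= K * `|k| ^+ 2.
Proof.
move=> sg; have [mg [C C0 gC]] := sg.
pose K0 := C * (2 * e ^- 2); have K00 : 0 <= K0.
  by rewrite !mulr_ge0// invr_ge0 exprn_ge0// ltW.
have IW0 : 0 <= \int[nu]_y W y.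
  by apply: Rintegral_ge0 => y _; exact: expR_ge0.
(* The added 1 makes the constant strictly positive, as [is_diff_quadratic] requires. *)
exists (K0 * (\int[nu]_y W y) + 1); first by rewrite ltr_wpDl// mulr_ge0.
move=> h k hh kk.
have hh1 : `|h - h0| <= 1%:R * e by rewrite mul1r.
have hk2 : `|h + k - h0| <= 2%:R * e.
  rewrite addrAC (le_trans (ler_normD _ _))//.
  by rewrite (_ : 2%:R * e = e + e) ?lerD//; ring.
have int1 := @integrable_subexp 2 1 g (h + k) isT sg hk2.
have int2 := @integrable_subexp 1 1 g h isT sg hh1.
have int3 a : nu.-integrable setT
    (EFin \o (fun y => k a 0 * (g y * t y a 0 * expR (tdot t y h)))).
  apply: integrableRZ; apply: (@integrable_subexp 1 2) => //.
  exact: (subexpM sg (subexp_t a)).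
have int4 := integrableR_sum (index_enum _) int3.
have int12 : nu.-integrable setT (EFin \o (fun y =>
    g y * expR (tdot t y (h + k)) - g y * expR (tdot t y h))).
  by have := integrableB measurableT int1 int2; apply: eq_integrable.
have int124 : nu.-integrable setT (EFin \o (fun y =>
    g y * expR (tdot t y (h + k)) - g y * expR (tdot t y h) -
    \sum_a k a 0 * (g y * t y a 0 * expR (tdot t y h)))).
  by have := integrableB measurableT int12 int4; apply: eq_integrable.
have -> : expint g (h + k) - expint g h -
    \sum_a k a 0 * expint (fun y => g y * t y a 0) h =
    \int[nu]_y (g y * expR (tdot t y (h + k)) - g y * expR (tdot t y h) -
      \sum_a k a 0 * (g y * t y a 0 * expR (tdot t y h))).
  rewrite RintegralB// RintegralB// Rintegral_sum//; congr (_ - _).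
  apply: eq_bigr => a _; rewrite RintegralZl//.
  by apply: (@integrable_subexp 1 2) => //; exact: (subexpM sg (subexp_t a)).
rewrite (le_trans (le_normr_Rintegral _ int124))//.
apply: (@le_trans _ _ (\int[nu]_y (K0 * `|k| ^+ 2 * W y))); last first.
  rewrite RintegralZl// mulrAC ler_wpM2r ?exprn_ge0//.
  by rewrite lerDl.
apply: le_Rintegral => //.
- by have := integrable_norm int124; apply: eq_integrable.
- exact: integrableRZ.
move=> y _.
have -> : g y * expR (tdot t y (h + k)) - g y * expR (tdot t y h) -
    \sum_a k a 0 * (g y * t y a 0 * expR (tdot t y h)) =
    g y * expR (tdot t y h) * (expR (tdot t y k) - 1 - tdot t y k).
  rewrite tdotD expRD mulrBr mulrBr; congr (_ - _); first by ring.
  by rewrite {3}/tdot mulr_sumr; apply: eq_bigr => a _; ring.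
have Sk : `|tdot t y k| <= e * S y.
  by rewrite (le_trans (norm_tdot_le _ _))// mulrC ler_wpM2r.
have taylor : `|expR (tdot t y k) - 1 - tdot t y k| <=
    (2 * e ^- 2 * expR (e * S y) * `|k| ^+ 2) * expR (e * S y).
  rewrite (le_trans (expR_taylor1_le _))//; apply: ler_pM => //.
  - exact: sqr_ge0.
  - apply: (@le_trans _ _ (S y ^+ 2 * `|k| ^+ 2)).
      by rewrite -exprMn -[leLHS]real_normK ?num_real// lerXn2r ?nnegrE// ?mulr_ge0// norm_tdot_le.
    by rewrite ler_wpM2r ?exprn_ge0// le_expR_S2.
  - by rewrite ler_expR.
rewrite !normrM (ger0_norm (expR_ge0 _)).
(* All four units of [e * S y] in [W] are spent: on [g], on the shift from [h0] to [h], on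
   [S y ^+ 2], and on the exponential in the Taylor bound. *)
have -> : K0 * `|k| ^+ 2 * W y =
    C * expR (1%:R * e * S y) * expR (tdot t y h0 + 1%:R * e * S y) *
    ((2 * e ^- 2 * expR (e * S y) * `|k| ^+ 2) * expR (e * S y)).
  have -> : W y = expR (1%:R * e * S y) * expR (tdot t y h0 + 1%:R * e * S y) *
      expR (e * S y) * expR (e * S y).
    by rewrite /W -!expRD; congr expR; ring.
  by rewrite /K0; ring.
apply: ler_pM => //; apply: ler_pM => //.
exact: expR_tdot_le.
Qed.

Lemma is_diff_expint g (h : 'cV[R]_m) : subexp 1 g -> `|h - h0| <= e ->
  is_diff h (expint g)
    (fun k => \sum_a k a 0 * expint (fun y => g y * t y a 0) h).
Proof.
move=> sg hh; set D := (X in is_diff _ _ X).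
have linD : linear D.
  move=> c u v; rewrite /D scaler_sumr -big_split; apply: eq_bigr => a _ /=.
  by rewrite !mxE mulrDl -mulrA.
pose dlM := GRing.isLinear.Build _ _ _ _ _ linD.
pose dL : {linear 'cV[R]_m -> R} := HB.pack D dlM.
have cD : continuous dL.
  move=> k; apply/differentiable_continuous.
  rewrite (_ : (dL : _ -> _) = \sum_a ((fun k : 'cV[R]_m => k a 0) *
    cst (expint (fun y => g y * t y a 0) h))); last first.
    by apply/funext => u; rewrite fct_sumE.
  apply: differentiable_sum => a; apply: differentiableM => //.
  exact: differentiable_coord.
have [K K0 HK] := expint_taylor1_le sg.
apply: (@is_diff_quadratic _ _ _ dL _ K e) => // k ke.
exact: HK.
Qed.

Lemma logpartE h : logpart nu t h = ln (expint (fun=> 1) h).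
Proof.
rewrite /logpart /partfun /expint /Rintegral; congr (ln (fine _)).
by apply: eq_integral => y _; rewrite mul1r.
Qed.

(** * Hessian of the log-likelihood along a parametrised map *)

Section AlongMap.
Context {V : normedModType R} (H : V -> 'cV[R]_m).
Hypothesis dH : forall a, twice_differentiable (fun x => H x a 0).

Lemma differentiable_col x : differentiable H x.
Proof.
rewrite (_ : H = \sum_a (fun x => H x a 0 *: (delta_mx a 0 : 'cV[R]_m))).
  by apply: differentiable_sum => a; apply: differentiableZl; have [] := dH a.
apply/funext => y; rewrite fct_sumE {1}(matrix_sum_delta (H y)).
by apply: eq_bigr => a _; rewrite big_ord1.
Qed.

Lemma differentiable_expint_comp g x : subexp 1 g -> `|H x - h0| <= e ->
  differentiable (fun x => expint g (H x)) x.
Proof.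
move=> sg hx; have [dg _] := is_diff_expint sg hx.
exact: (differentiable_comp (differentiable_col x) dg).
Qed.

Lemma derive_expint_comp g x v : subexp 1 g -> `|H x - h0| <= e ->
  'D_v (fun x => expint g (H x)) x =
  \sum_a 'D_v (fun x => H x a 0) x * expint (fun y => g y * t y a 0) (H x).
Proof.
move=> sg hx; have [dg dgE] := is_diff_expint sg hx.
have dHx := differentiable_col x.
rewrite (_ : (fun x => expint g (H x)) = expint g \o H)// deriveE; last first.
  exact: differentiable_comp.
rewrite diff_comp//= dgE; apply: eq_bigr => a _; congr (_ * _).
rewrite -deriveE// derive_mx; last exact: diff_derivable.
by rewrite mxE.
Qed.

Variable x0 : V.
Hypotheses (Hx0 : H x0 = h0) (Z_gt0 : 0 < expint (fun=> 1) h0).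

(** Both conditions follow from continuity at [x0]. The first-derivative formulas are available on
    this neighbourhood, which suffices for a second derivative at [x0]. *)
Lemma near_natparam_comp : \forall x \near x0,
  `|H x - h0| <= e /\ 0 < expint (fun=> 1) (H x).
Proof.
have x0e : `|H x0 - h0| <= e by rewrite Hx0 subrr normr0 ltW.
have cH : H x @[x --> x0] --> H x0.
  exact/differentiable_continuous/differentiable_col.
have cZ : expint (fun=> 1) (H x) @[x --> x0] --> expint (fun=> 1) (H x0).
  exact: (differentiable_continuous
    (differentiable_expint_comp subexp_cst1 x0e)).
near=> x; split.
  near: x; move/cvgrPdist_le : cH => /(_ _ e_gt0).
  by rewrite Hx0; apply: filterS => x; rewrite distrC.
by near: x; apply: (cvgr_gt _ cZ); rewrite Hx0.
Unshelve. all: by end_near. Qed.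

Lemma derivable_ln_expint1 x : 0 < expint (fun=> 1) (H x) ->
  derivable (@ln R) (expint (fun=> 1) (H x)) 1.
Proof. by move=> /is_derive1_ln[]. Qed.

Let logpart_compE : (fun x => logpart nu t (H x)) =
  (fun x => ln (expint (fun=> 1) (H x))).
Proof. by apply/funext => x; rewrite logpartE. Qed.

Lemma near_differentiable_logpart_comp : \forall x \near x0,
  differentiable (fun x => logpart nu t (H x)) x.
Proof.
apply: filterS near_natparam_comp => x [hx Zx]; rewrite logpart_compE.
apply: differentiable_comp.
  by apply: differentiable_expint_comp => //; exact: subexp_cst1.
exact/derivable1_diffP/derivable_ln_expint1.
Qed.

Lemma derivable_derive_logpart_comp v w :
  derivable (fun x => 'D_v (fun x => logpart nu t (H x)) x) x0 w.
Proof.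
(* The chain-rule formula for the derivative of [F o H] near [x0]: reciprocal of the partition
   function times its directional derivative. *)
pose Q x := (expint (fun=> 1) (H x))^-1 *
  \sum_a 'D_v (fun x => H x a 0) x * expint (fun y => t y a 0) (H x).
apply: (@near_eq_derivable _ _ _ Q).
  apply: filterS near_natparam_comp => x [hx Zx]; rewrite logpart_compE /Q.
  rewrite derive_compR; [|exact: derivable_ln_expint1|].
    rewrite derive1E; have [_ ->] := is_derive1_ln Zx.
    rewrite derive_expint_comp//; last exact: subexp_cst1.
    congr (_ * _); apply: eq_bigr => a _; congr (_ * expint _ _).
    by apply/funext => y; rewrite mul1r.
  by apply: differentiable_expint_comp => //; exact: subexp_cst1.
have x0e : `|H x0 - h0| <= e by rewrite Hx0 subrr normr0 ltW.
apply: diff_derivable; apply: differentiableM.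
  apply: differentiableV; last by rewrite Hx0 gt_eqF.
  by apply: differentiable_expint_comp => //; exact: subexp_cst1.
rewrite [X in differentiable X _](_ : _ = \sum_a
    ((fun x => 'D_v (fun x => H x a 0) x) *
     (fun x => expint (fun y => t y a 0) (H x)))); last first.
  by apply/funext => x; rewrite fct_sumE.
apply: differentiable_sum => a; apply: differentiableM.
  by have [_] := dH a; exact.
by apply: differentiable_expint_comp => //; exact: subexp_t.
Qed.

(** The logarithm undoes [expR], leaving a combination of outputs minus [F o H]. The first
    derivative is split on a neighbourhood of [x0], where [F o H] is differentiable, and the second
    derivative is then taken at [x0]. *)
Lemma derive_loglik_comp y v w :
  'D_w (fun x => 'D_v (fun x => ln (expdens nu t (H x) y)) x) x0 =
  \sum_a t y a 0 * 'D_w (fun x => 'D_v (fun x => H x a 0) x) x0 -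
  'D_w (fun x => 'D_v (fun x => logpart nu t (H x)) x) x0.
Proof.
have dHa a x u : derivable (fun x => H x a 0) x u.
  by apply: diff_derivable; have [] := dH a.
have ddHa a x u u' : derivable (fun x => 'D_u (fun x => H x a 0) x) x u'.
  by apply: diff_derivable; have [_] := dH a; exact.
have dlin (f : 'I_m -> V -> R) x u : (forall a, derivable (f a) x u) ->
    is_derive x u (fun x => \sum_a t y a 0 * f a x) (\sum_a t y a 0 * 'D_u (f a) x).
  move=> df; rewrite (_ : (fun x => _) = \sum_a t y a 0 *: f a); last first.
    by apply/funext => z; rewrite fct_sumE.
  by apply: is_derive_sum => a; apply: is_deriveZ; exact: derivableP.
have -> : (fun x => ln (expdens nu t (H x) y)) =
    (fun x => \sum_a t y a 0 * H x a 0) - (fun x => logpart nu t (H x)).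
  by apply/funext => x; rewrite /expdens expRK.
transitivity ('D_w ((fun x => \sum_a t y a 0 * 'D_v (fun x => H x a 0) x) -
    (fun x => 'D_v (fun x => logpart nu t (H x)) x)) x0).
  apply: near_eq_derive.
  apply: filterS near_differentiable_logpart_comp => x dx.
  have [dl lE] := dlin (fun a x => H x a 0) x v (fun a => dHa a x v).
  by rewrite deriveB ?lE//; exact: diff_derivable.
have [dl lE] := dlin (fun a x => 'D_v (fun x => H x a 0) x) x0 w
  (fun a => ddHa a x0 v w).
by rewrite deriveB// ?lE//; exact: derivable_derive_logpart_comp.
Qed.

End AlongMap.

End ExponentialMoments.

(** * Pairwise independence of the samples *)

Lemma mutually_independent_pair (R : realType) (dO d : measure_display)
    (Om : measurableType dO) (Y : measurableType d) (P : probability Om R)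
    (N : nat) (Ys : 'I_N -> Om -> Y) :
  (forall i, measurable_fun setT (Ys i)) -> mutually_independent P Ys ->
  forall i j, i != j -> forall A B, measurable A -> measurable B ->
  P (Ys i @^-1` A `&` Ys j @^-1` B) = (P (Ys i @^-1` A) * P (Ys j @^-1` B))%E.
Proof.
move=> mYs ind i j ij A B mA mB.
(* Full sets at the remaining indices contribute probability 1, so the product over all samples
   reduces to two factors. *)
pose E k := if k == i then A else if k == j then B else setT.
have mE k : measurable (E k).
  by rewrite /E; case: ifP => // _; case: ifP.
have Pfin k C : measurable C -> P (Ys k @^-1` C) \is a fin_num.
  move=> mC; apply: fin_num_measure.
  by rewrite -[X in measurable X]setTI; exact: mYs.
have := ind E mE.
rewrite (bigD1 i)//= (bigD1 j)/=; last by rewrite eq_sym.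
rewrite big1 ?mulr1; last first.
  move=> k /andP[/negbTE ki /negbTE kj].
  by rewrite /E ki kj preimage_setT probability_setT.
rewrite {2 3}/E eqxx (eq_sym j) (negbTE ij) eqxx EFinM !fineK; try exact: Pfin.
move=> <-; congr (P _); apply/seteqP; split=> w /=.
  by move=> [wA wB] k _; rewrite /E /=; case: eqVneq => [->//|_]; case: eqVneq => [->|].
move=> h; split.
  by have := h i I; rewrite /E/= eqxx.
by have := h j I; rewrite /E/= eqxx eq_sym (negbTE ij).
Qed.

(** * Expectations under the law of one sample *)

Section Sampling.
Context (R : realType) (d dO : measure_display) (Y : measurableType d)
  (Om : measurableType dO) (m : nat) (nu : {measure set Y -> \bar R})
  (t : Y -> 'cV[R]_m) (P : probability Om R) (h : 'cV[R]_m) (X : Om -> Y).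
Hypotheses (mt : forall a, measurable_fun setT (fun y => t y a 0))
  (mX : measurable_fun setT X).
Hypothesis law : forall A, measurable A ->
  P (X @^-1` A) = (\int[nu]_(y in A) (expdens nu t h y)%:E)%E.

Let X_mfun : {mfun Om >-> Y} := HB.pack X (isMeasurableFun.Build _ _ _ _ _ mX).
Let mu : probability Y R := distribution P X_mfun.

Let measurable_expdens : measurable_fun setT (expdens nu t h).
Proof.
by apply: measurableT_comp => //; apply: measurable_funB => //; exact: measurable_tdot.
Qed.

Lemma expdensE y : expdens nu t h y = expR (- logpart nu t h) * expR (tdot t y h).
Proof. by rewrite -expRD addrC. Qed.

Lemma integrable_expdens g :
  nu.-integrable setT (EFin \o (fun y => g y * expR (tdot t y h))) ->
  nu.-integrable setT (fun y => (g y * expdens nu t h y)%:E).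
Proof.
move=> /(integrableRZ (expR (- logpart nu t h))); apply: eq_integrable => //.
by move=> y _ /=; rewrite expdensE mulrCA.
Qed.

(** Integrability passes from [nu] to the law of [X] through the density, and from that law to [P]
    by pushforward. *)
Lemma integrable_sample (g : Y -> R) : measurable_fun setT g ->
  nu.-integrable setT (EFin \o (fun y => g y * expR (tdot t y h))) ->
  P.-integrable setT (EFin \o (g \o X)).
Proof.
move=> mg /integrable_expdens intg.
have /integrableP[_] : mu.-integrable setT (EFin \o g).
  exact: (integrable_density (mu := mu) measurable_expdens
    (fun=> expR_ge0 _) law mg intg).
rewrite ge0_integral_pushforward//=; last by do 2 apply: measurableT_comp => //.
move=> fin; apply/integrableP; split=> //.
by apply/measurable_EFinP; exact: measurableT_comp.
Qed.

Lemma Exp_sample (g : Y -> R) : measurable_fun setT g ->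
  nu.-integrable setT (EFin \o (fun y => g y * expR (tdot t y h))) ->
  Exp P (g \o X) = expfE nu t h g.
Proof.
move=> mg intg; have := integrable_sample mg intg; rewrite /Exp /expfE => intgX.
congr fine; rewrite -(integral_density (mu := mu) measurable_expdens _ law)//; last first.
  by move=> y; exact: expR_ge0.
by rewrite integral_pushforward//; exact/measurable_EFinP.
Qed.

(** If the partition function vanished, the density would integrate to 0, while by [law] it
    integrates to the total mass 1 of [P]. *)
Lemma expint1_gt0 : natparam nu t h -> 0 < expint nu t (fun=> 1) h.
Proof.
rewrite /natparam/= => hfin.
have p0 : (0 <= partfun nu t h)%E.
  by apply: integral_ge0 => y _; rewrite lee_fin expR_ge0.
have -> : expint nu t (fun=> 1) h = fine (partfun nu t h).
  by rewrite /expint /Rintegral; congr fine; apply: eq_integral => y _; rewrite mul1r.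
rewrite lt_neqAle fine_ge0// andbT eq_sym; apply/eqP => p_eq0.
have pE0 : partfun nu t h = 0%E.
  by rewrite -[LHS]fineK ?p_eq0// ge0_fin_numE.
have := law measurableT; rewrite preimage_setT probability_setT.
under eq_integral do rewrite expdensE EFinM.
rewrite ge0_integralZl//=.
- rewrite -/(partfun nu t h) pE0 mule0 => /eqP.
  by rewrite onee_eq0.
- by apply/measurable_EFinP/measurableT_comp => //; exact: measurable_tdot.
Qed.

End Sampling.

(** * Assembly of the covariance bound for the estimator *)

Unset Implicit Arguments.

Theorem mainTheorem7 (R : realType)
  (* network: depth L >= 1, widths n_0 = dim x, n_1, ..., n_L >= 1 *)
  (L : nat) (n : nat -> nat) (x : 'cV[R]_(n 0%N)) (sigma : R -> R)
  (hL1 : (0 < L)%N) (hn : forall l : nat, (1 <= l <= L)%N -> (0 < n l)%N)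
  (hsigma : C2 sigma)
  (* exponential family: base measure nu, sufficient statistic t *)
  (dY : measure_display) (Y : measurableType dY)
  (nu : {measure set Y -> \bar R}) (t : Y -> 'cV[R]_(n L))
  (ht : forall a : 'I_(n L), measurable_fun setT (fun y => t y a 0))
  (* parameter theta, with h_L in the interior of the natural parameter space *)
  (theta : 'rV[R]_(dimTheta n L))
  (hint : interior (natparam nu t) (@hL R n L sigma x theta))
  (* N i.i.d. samples y_i ~ p(y | x, theta) *)
  (N : nat) (hN : (0 < N)%N)
  (dO : measure_display) (Om : measurableType dO) (P : probability Om R)
  (Ys : 'I_N -> Om -> Y)
  (hYm : forall i, measurable_fun setT (Ys i))
  (hlaw : forall (i : 'I_N) (A : set Y), measurable A ->
     P (Ys i @^-1` A) =
     (\int[nu]_(y in A) (expdens nu t (@hL R n L sigma x theta) y)%:E)%E)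
  (hind : mutually_independent P Ys) :
  let loglik := fun (th : 'rV[R]_(dimTheta n L)) (y : Y) =>
    ln (expdens nu t (@hL R n L sigma x th) y) in
  let Ihat := fun (p q : 'I_(dimTheta n L)) (w : Om) =>
    N%:R^-1 * \sum_(i < N) - d2 (fun th => loglik th (Ys i w)) theta p q in
  let H := fun (a : 'I_(n L)) (p q : 'I_(dimTheta n L)) =>
    d2 (fun th => @hL R n L sigma x th a 0) theta p q in
  Num.sqrt (\sum_(p < dimTheta n L) \sum_(q < dimTheta n L)
            \sum_(r < dimTheta n L) \sum_(s < dimTheta n L)
              (Cov P (Ihat p q) (Ihat r s)) ^+ 2)
  <= N%:R^-1 *
     (\sum_(a < n L) \sum_(p < dimTheta n L) \sum_(q < dimTheta n L)
        (H a p q) ^+ 2) *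
     Num.sqrt (\sum_(a < n L) \sum_(b < n L)
        (fisherI nu t (@hL R n L sigma x theta) a b) ^+ 2).
Proof.
cbv zeta.
set Ihat := fun (p q : 'I_(dimTheta n L)) (w : Om) =>
  N%:R^-1 * \sum_(i < N)
    - d2 (fun th => ln (expdens nu t (hL sigma x th) (Ys i w))) theta p q.
pose H a p q := d2 (fun th => hL sigma x th a 0) theta p q.
set h0 := hL sigma x theta.
have [ds [dds _]] := hsigma.
pose Hmap (th : 'rV[R]_(dimTheta n L)) := hL sigma x th.
have dH a : twice_differentiable (fun th => Hmap th a 0).
  exact: twice_differentiable_layer.
have [e4 e4_gt0 intW4] := integrable_expR_tdot_norm ht hint.
(* The exponential room [e4] is cut into the four units used by [subexp]. *)
pose e := e4 / 4.
have e_gt0 : 0 < e by rewrite divr_gt0.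
have intW : nu.-integrable setT (EFin \o (fun y =>
    expR (tdot t y h0 + 4 * e * \sum_a `|t y a 0|))).
  by move: intW4; rewrite /e mulrCA divff ?mulr1.
(* The law of any one sample shows that the partition function at [h0] is positive. *)
have i0 : 'I_N := Ordinal hN.
have Z_gt0 : 0 < expint nu t (fun=> 1) h0.
  by apply: (expint1_gt0 ht (hlaw i0)); exact: interior_subset hint.
pose mean a := expfE nu t h0 (fun y => t y a 0).
pose X i a w := t (Ys i w) a 0 - mean a.
(* No shift from [h0] is made, so all four units are available to the integrand; a product of two
   centred statistics uses two. *)
have h0e : `|h0 - h0| <= 0%:R * e by rewrite subrr normr0 mul0r.
have intg j g : subexp t e j g -> (j <= 4)%N ->
    nu.-integrable setT (EFin \o (fun y => g y * expR (tdot t y h0))).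
  by move=> sg j4; exact: (integrable_subexp ht e_gt0 intW (i := 0) j4 sg h0e).
have st a : subexp t e 1 (fun y => t y a 0) by exact: subexp_t.
have sc a : subexp t e 1 (fun y => t y a 0 - mean a) by exact: subexpB_cst.
have intX i a : P.-integrable setT (EFin \o X i a).
  have [mg _] := sc a.
  exact: (integrable_sample ht (hYm i) (hlaw i) mg (intg _ _ (sc a) isT)).
have EX i a : Exp P (X i a) = 0.
  have intt := integrable_sample ht (hYm i) (hlaw i) (ht a) (intg _ _ (st a) isT).
  rewrite (_ : X i a = (fun w => - mean a + t (Ys i w) a 0)); last first.
    by apply/funext => w; rewrite addrC.
  rewrite Exp_affine// [X in _ + X](_ : _ = mean a) ?addNr//.
  exact: (Exp_sample ht (hYm i) (hlaw i) (ht a) (intg _ _ (st a) isT)).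
have indep i j : i != j -> _ := @mutually_independent_pair _ _ _ _ _ P N Ys hYm hind i j.
have intXX i j a b :
    P.-integrable setT (EFin \o (fun w => X i a w * X j b w)).
  have [mga _] := sc a; have [mgb _] := sc b.
  have [<-|ij] := eqVneq i j.
    have sab := subexpM (sc a) (sc b); have [mab _] := sab.
    exact: (integrable_sample ht (hYm i) (hlaw i) mab (intg _ _ sab isT)).
  exact: (integrable_indep_mul (hYm i) (hYm j) (indep _ _ ij) mga mgb
    (intX i a) (intX j b)).
have EXX i j a b : Exp P (fun w => X i a w * X j b w) =
    if i == j then fisherI nu t h0 a b else 0.
  have [mga _] := sc a; have [mgb _] := sc b.
  have [<-|ij] := eqVneq i j.
    have sab := subexpM (sc a) (sc b); have [mab _] := sab.
    exact: (Exp_sample ht (hYm i) (hlaw i) mab (intg _ _ sab isT)).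
  (* Distinct samples are independent and centred, so the mixed moment is a product of zeros. *)
  transitivity (Exp P (X i a) * Exp P (X j b)); last by rewrite EX mul0r.
  exact: (Rintegral_indep_mul (hYm i) (hYm j) (indep _ _ ij) mga mgb
    (intX i a) (intX j b)).
pose c p q := d2 (fun th => logpart nu t (Hmap th)) theta p q.
(* Writing each statistic as its mean plus [X i a] puts the estimator in the affine form of
   [Cov_affine_sum], with coefficients [- H a p q]. *)
have IhatE p q : Ihat p q = fun w =>
    (c p q - \sum_a H a p q * mean a) +
    N%:R^-1 * \sum_i \sum_a - H a p q * X i a w.
  apply/funext => w; rewrite /Ihat.
  have N0 : N%:R != 0 :> R by rewrite pnatr_eq0 -lt0n.
  have -> : c p q - \sum_a H a p q * mean a =
      N%:R^-1 * \sum_(i < N) (c p q - \sum_a H a p q * mean a).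
    by rewrite sumr_const card_ord -[X in _ * X]mulr_natl mulrA mulVf// mul1r.
  rewrite -mulrDr -big_split; congr (_ * _); apply: eq_bigr => i _ /=.
  rewrite /d2 (derive_loglik_comp ht e_gt0 intW dH erefl Z_gt0).
  rewrite opprB -addrA; congr (_ + _).
  rewrite -!sumrN -big_split; apply: eq_bigr => a _ /=.
  by rewrite /X /H /d2; ring.
(* The factor [N%:R^-1 ^+ 2] times the [N] diagonal terms leaves [N%:R^-1], and the two minus signs
   cancel. *)
have CovE p q r s : Cov P (Ihat p q) (Ihat r s) =
    N%:R^-1 * \sum_a \sum_b H a p q * H b r s * fisherI nu t h0 a b.
  rewrite !IhatE (Cov_affine_sum intX EX intXX EXX) card_ord.
  rewrite expr2 -[_ * _ * N%:R]mulrA mulVf ?pnatr_eq0 -?lt0n// mulr1.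
  congr (_ * _); apply: eq_bigr => a _; apply: eq_bigr => b _.
  by rewrite mulrNN.
rewrite -/h0 (eq_bigr (fun p => \sum_q \sum_r \sum_s
  (N%:R^-1 * \sum_a \sum_b H a p q * H b r s * fisherI nu t h0 a b) ^+ 2)).
  by apply: frobenius_bilinear_le; rewrite invr_ge0.
move=> p _; apply: eq_bigr => q _; apply: eq_bigr => r _; apply: eq_bigr => s _.
by rewrite CovE.
Qed.
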